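(* Let $d\ge 1$ and let $f\colon[0,\infty)\to\mathbb{R}$ be an admissible kernel profile in dimension $d$, with associated multiscale kernel $K$. Suppose that $f$ is differentiable and that there exists a constant $A_1>0$ such that $r^{3/2}|f'(r)|\le A_1$ for all $r\ge 0$. Let $\sigma>0$. If $\alpha\in\mathcal{P}_1(\mathbb{R}^d)$ and $y_i\in\mathbb{R}^d$, $i\in\mathbb{N}$, are i.i.d. random variables with distribution $\alpha$, and $\alpha_n=\frac1n\sum_{i=1}^n\delta_{y_i}$, then $$\sup_{x\in\mathbb{R}^d}\left\|\Sigma_{\alpha_n}(x,\sigma)-\Sigma_\alpha(x,\sigma)\right\|\longrightarrow 0\quad\text{as } n\to\infty,$$ almost surely.
   Context: An admissible kernel profile in dimension $d$ is a bounded measurable function $f\colon[0,\infty)\to\mathbb{R}$ such that (a) $f(r)\ge 0$ for all $r$; (b) $M_d=\int_0^\infty r^{\frac d2-1}f(r)\,dr<\infty$; (c) there is $C>0$ with $rf(r)\le C$ for all $r\ge0$; normalized so that $\sup f=1$. The associated multiscale kernel is $K(x,y,\sigma)=\frac{1}{C_d(\sigma)}f\!\left(\frac{\|y-x\|^2}{\sigma^2}\right)$, where $C_d(\sigma)=\frac12\sigma^dM_d\,\omega_{d-1}$ and $\omega_{d-1}=2\pi^{d/2}/\Gamma(d/2)$. For a Borel probability measure $\alpha$ on $\mathbb{R}^d$, $\Sigma_\alpha(x,\sigma)=\int_{\mathbb{R}^d}(y-x)\otimes(y-x)K(x,y,\sigma)\,\alpha(dy)\in\mathbb{R}^d\otimes\mathbb{R}^d$.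 Identifying $x\otimes y$ with the matrix $xy^T$, $\|\cdot\|$ is the Frobenius norm. $\mathcal{P}_1(\mathbb{R}^d)$ is the set of Borel probability measures on $\mathbb{R}^d$ with finite first moment. *)

(* Defs.v *)
From HB Require Import structures.
From mathcomp Require Import all_boot all_order all_algebra finmap.
From mathcomp Require Import all_classical all_reals all_analysis.

Set Implicit Arguments.
Unset Strict Implicit.
Unset Printing Implicit Defensive.

Import Order.TTheory GRing.Theory Num.Theory.
Import numFieldNormedType.Exports.

Local Open Scope classical_set_scope.
Local Open Scope ring_scope.

(* The Borel sigma-algebra on matrices, hence on R^d = 'cV[R]_d; the topology
   is the library's (product) topology. *)
HB.instance Definition _ (R : realType) (m n : nat) :=
  @isMeasurable.Build (sigma_display (@open 'M[R]_(m, n))) 'M[R]_(m, n)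
    <<s @open 'M[R]_(m, n) >> (@sigma_algebra0 _ setT open)
    (@sigma_algebraC _ open) (@sigma_algebra_bigcup _ setT open).

(* The library norm on matrices is the max norm, so the Frobenius norm is
   defined here; on column vectors it is the Euclidean norm. *)
Definition frobenius (R : realType) (m n : nat) (A : 'M[R]_(m, n)) : R :=
  Num.sqrt (\sum_i \sum_j A i j ^+ 2).

Definition Gamma (R : realType) (s : R) : R :=
  \int[lebesgue_measure]_(t in `]0, +oo[) (t `^ (s - 1) * expR (- t)).

(* omega_{d-1}, the surface area of the unit sphere of R^d *)
Definition sphere_area (R : realType) (d : nat) : R :=
  2 * pi `^ (d%:R / 2) / Gamma (d%:R / 2 : R).

(* M_d *)
Definition profile_moment (R : realType) (d : nat) (f : R -> R) : \bar R :=
  \int[lebesgue_measure]_(r in `[0, +oo[) (r `^ (d%:R / 2 - 1) * f r)%:E.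

(* A profile is a function on [0, +oo[: it is represented by a total function,
   whose values at negative arguments are never constrained nor used. *)
Record admissible_profile (R : realType) (d : nat) (f : R -> R) : Prop :=
  AdmissibleProfile {
    profile_measurable : measurable_fun (`[0, +oo[ : set R) f ;
    profile_bounded : exists M : R, forall r : R, 0 <= r -> `|f r| <= M ;
    profile_ge0 : forall r : R, 0 <= r -> 0 <= f r ;
    profile_moment_fin : (profile_moment d f < +oo)%E ;
    profile_decay : exists2 C : R, 0 < C & forall r : R, 0 <= r -> r * f r <= C ;
    profile_sup : sup (f @` `[0, +oo[) = 1 }.

(* Differentiability on [0, +oo[: one-sided at the end point 0. The derivative
   at r > 0 is the library's [derive1 f r]; [derive1 f 0], which sees negative
   arguments, is meaningless here and may only occur multiplied by 0. *)
Definition differentiable_profile (R : realType) (f : R -> R) : Prop :=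
  (forall r : R, 0 < r -> derivable f r 1) /\
  cvg ((fun h => (f h - f 0) / h) @ (0 : R)^'+).

(* C_d(sigma) *)
Definition kernel_normalization (R : realType) (d : nat) (f : R -> R)
    (sigma : R) : R :=
  2^-1 * sigma ^+ d * fine (profile_moment d f) * sphere_area R d.

Definition multiscale_kernel (R : realType) (d : nat) (f : R -> R)
    (x y : 'cV[R]_d) (sigma : R) : R :=
  (kernel_normalization d f sigma)^-1 * f (frobenius (y - x) ^+ 2 / sigma ^+ 2).

(* Sigma_mu(x, sigma); the matrix-valued integral is taken entrywise. *)
Definition multiscale_covariance (R : realType) (d : nat) (f : R -> R)
    (mu : {measure set 'cV[R]_d -> \bar R}) (x : 'cV[R]_d) (sigma : R)
    : 'M[R]_d :=
  \matrix_(i, j) \int[mu]_y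
    (((y - x) *m (y - x)^T) i j * multiscale_kernel f x y sigma).

Definition finite_first_moment (R : realType) (d : nat)
    (mu : {measure set 'cV[R]_d -> \bar R}) : Prop :=
  (\int[mu]_y (frobenius y)%:E < +oo)%E.

Definition mutually_independent (R : realType) (d d' : measure_display)
    (T : measurableType d) (T' : measurableType d') (P : probability T R)
    (I : choiceType) (X : I -> {RV P >-> T'}) : Prop :=
  forall (J : {fset I}) (A : I -> set T'),
    (forall i, measurable (A i)) ->
    P (\bigcap_(i in [set` J]) (X i @^-1` A i))
    = (\prod_(i <- J) P (X i @^-1` A i))%E.

Definition iid_with_distribution (R : realType) (d d' : measure_display)
    (T : measurableType d) (T' : measurableType d') (P : probability T R)
    (X : nat -> {RV P >-> T'}) (mu : probability T' R) : Prop :=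
  mutually_independent X /\
  (forall i (A : set T'), measurable A -> distribution P (X i) A = mu A).

(* (1/n) sum_{i < n} delta_{y i}; indices start at 0, and n = 0 gives the zero
   measure. *)
Definition empirical_measure (R : realType) (d : measure_display)
    (T : measurableType d) (y : nat -> T) (n : nat)
    : {measure set T -> \bar R} :=
  mscale (n%:R^-1)%:nng (msum (fun i => \d_(y i)) n).

(* Main.v *)
(* The entries of Sigma_mu(x, sigma) are integrals against mu of the functions
   y |-> F (y - x) with F z = z_i z_j g(|z|), where g(s) = c f(s^2 / sigma^2).
   The bound on r f(r) makes F bounded, and together with the bound on
   r^(3/2) |f'(r)| it makes F Lipschitz; hence all these functions share one
   bound and one Lipschitz constant.  Cut R^d into countably many grid cells of
   small diameter: up to the mass of the cells of index at least N and an error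
   controlled by the mesh, such an integral only depends on the masses of the
   first N cells.  So the almost sure convergence of the empirical masses of
   countably many events, which follows from second moments along the squares
   n = k^2, already gives uniform convergence over x. *)

Require Import Defs.
From mathcomp Require Import all_boot all_order all_algebra finmap.
From mathcomp Require Import all_classical all_reals all_analysis.
From mathcomp Require Import measurable_realfun.
From mathcomp Require Import ring lra zify.

Set Implicit Arguments.
Unset Strict Implicit.
Unset Printing Implicit Defensive.

Import Order.TTheory GRing.Theory Num.Theory.
Import numFieldNormedType.Exports.

Local Open Scope classical_set_scope.
Local Open Scope ring_scope.

(** * Bounded measurable functions and their integrals against finite measures *)

Definition bounded_measurable (R : realType) (disp : measure_display)
    (T : measurableType disp) (g : T -> R) : Prop :=
  measurable_fun setT g /\ exists B : R, forall x, `|g x| <= B.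

Lemma bounded_measurable_cst (R : realType) (disp : measure_display)
    (T : measurableType disp) (c : R) :
  bounded_measurable (fun _ : T => c).
Proof. by split; [exact: measurable_cst | exists `|c|]. Qed.

Lemma bounded_measurable_indic (R : realType) (disp : measure_display)
    (T : measurableType disp) (A : set T) :
  measurable A -> bounded_measurable (\1_A : T -> R).
Proof.
move=> mA; split; first exact: measurable_indic.
by exists 1 => x; rewrite indicE normr_nat lern1 leq_b1.
Qed.

Lemma bounded_measurableD (R : realType) (disp : measure_display)
    (T : measurableType disp) (g h : T -> R) :
  bounded_measurable g -> bounded_measurable h ->
  bounded_measurable (fun x => g x + h x).
Proof.
move=> [mg [B gB]] [mh [C hC]]; split; first exact: measurable_funD.
by exists (B + C) => x; rewrite (le_trans (ler_normD _ _))// lerD.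
Qed.

Lemma bounded_measurableM (R : realType) (disp : measure_display)
    (T : measurableType disp) (g h : T -> R) :
  bounded_measurable g -> bounded_measurable h ->
  bounded_measurable (fun x => g x * h x).
Proof.
move=> [mg [B gB]] [mh [C hC]]; split; first exact: measurable_funM.
by exists (B * C) => x; rewrite normrM ler_pM.
Qed.

Lemma bounded_measurableN (R : realType) (disp : measure_display)
    (T : measurableType disp) (g : T -> R) :
  bounded_measurable g -> bounded_measurable (fun x => - g x).
Proof.
move=> [mg [B gB]]; split; first exact: measurableT_comp.
by exists B => x; rewrite normrN.
Qed.

Lemma bounded_measurableB (R : realType) (disp : measure_display)
    (T : measurableType disp) (g h : T -> R) :
  bounded_measurable g -> bounded_measurable h ->
  bounded_measurable (fun x => g x - h x).
Proof.
by move=> bg bh; apply: bounded_measurableD => //; exact: bounded_measurableN.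
Qed.

Lemma bounded_measurable_norm (R : realType) (disp : measure_display)
    (T : measurableType disp) (g : T -> R) :
  bounded_measurable g -> bounded_measurable (fun x => `|g x|).
Proof.
move=> [mg [B gB]]; split; first exact: measurableT_comp.
by exists B => x; rewrite normr_id.
Qed.

Lemma bounded_measurable_sum (R : realType) (disp : measure_display)
    (T : measurableType disp) (g : nat -> T -> R) (n : nat) :
  (forall i, bounded_measurable (g i)) ->
  bounded_measurable (fun x => \sum_(i < n) g i x).
Proof.
move=> bg; elim: n => [|n IHn].
  by under eq_fun do rewrite big_ord0; exact: bounded_measurable_cst.
under eq_fun do rewrite big_ord_recr /=.
exact: bounded_measurableD.
Qed.

Lemma bounded_measurable_integrable (R : realType) (disp : measure_display)
    (T : measurableType disp) (mu : {measure set T -> \bar R}) (g : T -> R) :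
  (mu setT < +oo)%E -> bounded_measurable g -> mu.-integrable setT (EFin \o g).
Proof.
move=> mufin [mg [B gB]]; apply: measurable_bounded_integrable => //.
exists B; split; first exact: num_real.
by move=> M BM x _; apply: le_trans (gB x) _; exact: ltW.
Qed.

Lemma Rintegral_sum (R : realType) (disp : measure_display)
    (T : measurableType disp) (mu : {measure set T -> \bar R})
    (g : nat -> T -> R) (n : nat) :
  (mu setT < +oo)%E -> (forall i, bounded_measurable (g i)) ->
  \int[mu]_x (\sum_(i < n) g i x) = \sum_(i < n) \int[mu]_x g i x.
Proof.
move=> mufin bg; elim: n => [|n IHn].
  under eq_Rintegral do rewrite big_ord0.
  by rewrite Rintegral_cst// mul0r big_ord0.
under eq_Rintegral do rewrite big_ord_recr /=.
rewrite RintegralD//; first by rewrite IHn big_ord_recr.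
- by apply: bounded_measurable_integrable => //; exact: bounded_measurable_sum.
- exact: bounded_measurable_integrable.
Qed.

Lemma Rintegral_indic (R : realType) (disp : measure_display)
    (T : measurableType disp) (mu : {measure set T -> \bar R}) (A : set T) :
  measurable A -> \int[mu]_x (\1_A x : R) = fine (mu A).
Proof. by move=> mA; rewrite /Rintegral integral_indic// setIT. Qed.

(** * A strong law of large numbers for events, from second moments along squares *)

Lemma sqrt_bracket (n : nat) : exists m : nat, (m ^ 2 <= n < m.+1 ^ 2)%N.
Proof.
elim: n => [|n [m /andP[mn nm]]]; first by exists 0%N.
have [nm'|nm'] := ltnP n.+1 (m.+1 ^ 2).
  by exists m; rewrite nm' (leq_trans mn).
by exists m.+1; rewrite nm' /=; move: nm; rewrite -!mulnn; nia.
Qed.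

(** For [m ^ 2 <= n < m.+1 ^ 2], at most [2 * m] terms of size at most 1 separate the sums up to
    [m ^ 2] and up to [n]; this is negligible against [m ^ 2 <= n]. *)
Lemma cesaro_mean_squares (R : realType) (a : nat -> R) :
  (forall i, `|a i| <= 1) ->
  (fun k => (\sum_(i < k.+1 ^ 2) a i) / (k.+1 ^ 2)%:R) @ \oo --> (0 : R) ->
  (fun n => n%:R^-1 * \sum_(i < n) a i) @ \oo --> (0 : R).
Proof.
move=> a1 sq0; apply/cvgr0Pnorm_le => e e0.
have e20 : 0 < e / 2 by rewrite divr_gt0.
have /cvgr0Pnorm_le/(_ _ e20) [K _ HK] := sq0.
(* Once [m] exceeds [K], the sum up to [m ^ 2] is at most [e / 2 * m ^ 2]; once [m] exceeds [4 / e],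
   the remainder [2 * m] is at most [e / 2 * m ^ 2] as well. *)
pose K' := maxn K.+1 (Num.bound (4 / e)).
have K'e : 4 / e < K'%:R.
  rewrite (lt_le_trans (archi_boundP _))//; first by rewrite divr_ge0// ltW.
  by rewrite ler_nat leq_maxr.
have K'0 : (0 < K')%N by rewrite (leq_trans _ (leq_maxl _ _)).
exists (K' ^ 2)%N => //= n Kn.
have [m /andP[mn nm]] := sqrt_bracket n.
have K'm : (K' <= m)%N.
  by rewrite leqNgt; apply/negP => mK'; move: Kn nm; rewrite /= -!mulnn; nia.
have m0 : (0 < m)%N by exact: leq_trans K'0 K'm.
have n0 : (0 < n)%N by rewrite (leq_trans _ mn)// expn_gt0 m0.
have nR0 : 0 < n%:R :> R by rewrite ltr0n.
have mR0 : 0 < m%:R :> R by rewrite ltr0n.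
rewrite normrM ger0_norm ?invr_ge0// mulrC ler_pdivrMr//.
have Sm : `|\sum_(i < m ^ 2) a i| <= e / 2 * (m ^ 2)%:R.
  (* The sequence of square means has the square of [k.+1] at index [k], so [m ^ 2] sits at index
     [m.-1]. *)
  have := HK m.-1; rewrite /= prednK//.
  have -> : (K <= m.-1)%N.
    by rewrite -ltnS prednK// (leq_trans _ K'm)// leq_maxl.
  move=> /(_ isT); rewrite normrM normfV normr_nat ler_pdivrMr//.
  by rewrite ltr0n expn_gt0 m0.
have -> : \sum_(i < n) a i =
    \sum_(i < m ^ 2) a i + \sum_(m ^ 2 <= i < n) a i.
  by rewrite -!(big_mkord xpredT a) -big_cat_nat.
rewrite (le_trans (ler_normD _ _))//.
have Tm : `|\sum_(m ^ 2 <= i < n) a i| <= 2 * m%:R.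
  rewrite (le_trans (ler_norm_sum _ _ _))//.
  rewrite (le_trans (ler_sum _ (fun i _ => a1 i)))//.
  rewrite sumr_const_nat -natrM ler_nat.
  by move: mn nm; rewrite -!mulnn; nia.
have em : 4 <= e * m%:R.
  rewrite mulrC -ler_pdivrMr// (le_trans (ltW K'e))// ler_nat//.
have mnR : (m ^ 2)%:R <= n%:R :> R by rewrite ler_nat.
have m2 : (m ^ 2)%:R = m%:R * m%:R :> R by rewrite -natrM mulnn.
rewrite m2 in mnR Sm.
nra.
Qed.

(** By induction the sum of the first [n] terms, [n >= 1], is at most [2 - 1 / n]: with [a = n], the
    slack in the inductive step is exactly [1 / (a * (a + 1) ^ 2)]. *)
Lemma nneseries_inv_sqr_lty (R : realType) :
  (\sum_(k <oo) (((k.+1 ^ 2)%:R : R)^-1)%:E < +oo)%E.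
Proof.
apply: (@le_lt_trans _ _ 2%:E); last exact: ltry.
apply: lime_le.
  by apply: is_cvg_nneseries => k _ _; rewrite lee_fin invr_ge0.
apply: nearW => n; rewrite big_mkord sumEFin lee_fin.
case: n => [|n]; first by rewrite big_ord0.
suff : \sum_(i < n.+1) ((i.+1 ^ 2)%:R : R)^-1 <= 2 - n.+1%:R^-1.
  by move=> /le_trans -> //; rewrite lerBlDr lerDl invr_ge0.
elim: n => [|n IHn]; first by rewrite big_ord1 !invr1; lra.
rewrite big_ord_recr /= (le_trans (lerD IHn (lexx _)))//.
have p1 : 0 < n.+1%:R :> R by [].
have p2 : 0 < n.+2%:R :> R by [].
have p12 : n.+2%:R = n.+1%:R + 1 :> R by rewrite -natr1.
rewrite -subr_ge0 (_ : _ - _ = (n.+1%:R * n.+2%:R ^+ 2)^-1); last first.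
  move: p2; rewrite natrX p12; move: (n.+1%:R) p1 => a a0 a10; field.
  by rewrite !gt_eqF.
by rewrite invr_ge0 mulr_ge0// exprn_ge0// ltW.
Qed.

Lemma cvg0_nneseries_sqr (R : realType) (u : nat -> R) :
  (\sum_(k <oo) (u k ^+ 2)%:E < +oo)%E -> u @ \oo --> (0 : R).
Proof.
move=> ufin.
have cu2 : (fun k => u k ^+ 2) @ \oo --> (0 : R).
  apply: cvg_series_cvg_0; apply: nondecreasing_is_cvgn.
    apply: nondecreasing_series => n _ _; exact: sqr_ge0.
  have u_ge0 : (0 <= \sum_(k <oo) (u k ^+ 2)%:E)%E.
    by apply: nneseries_ge0 => k _ _; rewrite lee_fin sqr_ge0.
  exists (fine (\sum_(k <oo) (u k ^+ 2)%:E)%E) => _ [n _ <-].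
  rewrite -lee_fin fineK ?ge0_fin_numE//.
  rewrite /series/= -sumEFin; apply: nneseries_lim_ge => k _.
  by rewrite lee_fin sqr_ge0.
apply/cvgr0Pnorm_le => e e0.
have e20 : 0 < e ^+ 2 by rewrite exprn_gt0.
move/cvgr0Pnorm_le/(_ _ e20) : cu2; apply: filterS => k.
by rewrite normrX ler_pXn2r// nnegrE// ltW.
Qed.

(** Orthogonality leaves only the diagonal terms, so the sum of the first [n] variables has second
    moment at most [n], and its mean at most [1 / n]. Along squares this is summable; exchanging sum
    and integral, the series of squared means is almost surely finite, so its terms tend to 0.
    [cesaro_mean_squares] fills the gaps between squares. *)
Lemma orthogonal_strong_law (R : realType) (disp : measure_display)
    (T : measurableType disp) (P : probability T R) (xi : nat -> T -> R) :
  (forall i, measurable_fun setT (xi i)) ->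
  (forall i w, `|xi i w| <= 1) ->
  (forall i j, i != j -> \int[P]_w (xi i w * xi j w) = 0) ->
  {ae P, forall w, (fun n => n%:R^-1 * \sum_(i < n) xi i w) @ \oo --> (0 : R)}.
Proof.
move=> mxi xi1 xi0.
have Pfin : (P setT < +oo)%E by rewrite probability_setT ltry.
have P1 : fine (P setT) = 1 by rewrite probability_setT.
have bxi i : bounded_measurable (xi i) by split; [|exists 1].
pose S n w := \sum_(i < n) xi i w.
have bS n : bounded_measurable (S n) by exact: bounded_measurable_sum.
have bS2 n : bounded_measurable (fun w => S n w ^+ 2).
  by under eq_fun do rewrite expr2; exact: bounded_measurableM.
have ES n : \int[P]_w (S n w ^+ 2) <= n%:R.
  have -> : \int[P]_w (S n w ^+ 2) =
      \sum_(i < n) \sum_(j < n) \int[P]_w (xi i w * xi j w).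
    under eq_Rintegral do rewrite expr2 mulr_suml.
    rewrite (@Rintegral_sum _ _ _ _ (fun i w => xi i w * S n w))//; last first.
      by move=> i; exact: bounded_measurableM.
    apply: eq_bigr => i _; under eq_Rintegral do rewrite mulr_sumr.
    rewrite (@Rintegral_sum _ _ _ _ (fun j w => xi i w * xi j w))// => j.
    exact: bounded_measurableM.
  rewrite -[n in n%:R]card_ord -sumr_const.
  apply: ler_sum => i _; rewrite (bigD1 i)//= big1 ?addr0; last first.
    by move=> j ji; apply: xi0; rewrite eq_sym.
  rewrite (_ : 1 = \int[P]_w (cst 1 w)); last first.
    by rewrite Rintegral_cst// mul1r P1.
  apply: le_Rintegral => //.
  - by apply: bounded_measurable_integrable => //; exact: bounded_measurableM.
  - by apply: bounded_measurable_integrable => //; exact: bounded_measurable_cst.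
  - by move=> w _ /=; rewrite (le_trans (ler_norm _))// normrM mulr_ile1.
(* Along the squares the second moments of the means are summable. *)
pose u k w := S (k.+1 ^ 2)%N w / (k.+1 ^ 2)%:R.
have bu2 k : bounded_measurable (fun w => u k w ^+ 2).
  under eq_fun do rewrite exprMn.
  by apply: bounded_measurableM => //; exact: bounded_measurable_cst.
have mu2 k : measurable_fun setT (fun w => (u k w ^+ 2)%:E).
  by apply/measurable_EFinP; exact: (bu2 k).1.
have Eu k : (\int[P]_w (u k w ^+ 2)%:E <= (((k.+1 ^ 2)%:R : R)^-1)%:E)%E.
  have iu2 := bounded_measurable_integrable Pfin (bu2 k).
  rewrite -(fineK (integrable_fin_num measurableT iu2)) lee_fin.
  rewrite -[leLHS]/(\int[P]_w (u k w ^+ 2)).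
  under eq_Rintegral do rewrite exprMn.
  rewrite RintegralZr//; last exact: bounded_measurable_integrable.
  rewrite (le_trans (ler_wpM2r _ (ES _)))// ?exprn_ge0 ?invr_ge0//.
  by rewrite expr2 mulrA divff ?mul1r// pnatr_eq0.
have Esum : (\int[P]_w (\sum_(k <oo) (u k w ^+ 2)%:E) < +oo)%E.
  rewrite integral_nneseries//; last first.
    by move=> k w _; rewrite lee_fin sqr_ge0.
  apply: le_lt_trans (nneseries_inv_sqr_lty R).
  apply: lee_nneseries => [k _ _|k _ //].
  by apply: integral_ge0 => w _; rewrite lee_fin sqr_ge0.
have iu : P.-integrable setT (fun w => \sum_(k <oo) (u k w ^+ 2)%:E)%E.
  apply/integrableP; split.
    apply: ge0_emeasurable_sum => // k w _ _; rewrite lee_fin; exact: sqr_ge0.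
  rewrite (eq_integral (fun w => \sum_(k <oo) (u k w ^+ 2)%:E)%E)// => w _.
  rewrite gee0_abs// nneseries_ge0// => k _ _; rewrite lee_fin; exact: sqr_ge0.
have := integrable_ae measurableT iu; apply: filterS => w /(_ I) wfin.
apply: (@cesaro_mean_squares _ (xi ^~ w)) => //; apply: cvg0_nneseries_sqr.
by move: wfin; rewrite ge0_fin_numE// nneseries_ge0// => k _ _; rewrite lee_fin sqr_ge0.
Qed.

(** The indicators centred at [p] are bounded by 1, and pairwise independence makes them
    orthogonal. *)
Lemma strong_law_events (R : realType) (disp : measure_display)
    (T : measurableType disp) (P : probability T R) (A : nat -> set T) (p : R) :
  (forall i, measurable (A i)) -> (forall i, P (A i) = p%:E) ->
  (forall i j, i != j -> P (A i `&` A j) = (p * p)%:E) ->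
  {ae P, forall w, (fun n => n%:R^-1 * \sum_(i < n) \1_(A i) w) @ \oo --> p}.
Proof.
move=> mA PA PAA.
have Pfin : (P setT < +oo)%E by rewrite probability_setT ltry.
have P1 : fine (P setT) = 1 by rewrite probability_setT.
have p01 : 0 <= p <= 1.
  by rewrite -!lee_fin -(PA 0%N) measure_ge0 probability_le1.
pose xi i w : R := \1_(A i) w - p.
have bA B : measurable B -> bounded_measurable (\1_B : T -> R).
  exact: bounded_measurable_indic.
have mxi i : measurable_fun setT (xi i).
  by apply: (bounded_measurableB _ _).1; [exact: bA|exact: bounded_measurable_cst].
have xi1 i w : `|xi i w| <= 1.
  rewrite /xi indicE; case: (w \in A i) => /=; rewrite ler_norml; lra.
have xi0 i j : i != j -> \int[P]_w (xi i w * xi j w) = 0.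
  move=> ij.
  have E w : xi i w * xi j w =
      (\1_(A i `&` A j) w - p * \1_(A i) w) - (p * \1_(A j) w - p * p).
    by rewrite /xi indicI/=; ring.
  under eq_Rintegral do rewrite E.
  have bc (c : R) : bounded_measurable (fun=> c : R).
    exact: bounded_measurable_cst.
  have bpA k : bounded_measurable (fun w => p * \1_(A k) w).
    by apply: bounded_measurableM => //; exact: bA.
  have bAA : bounded_measurable (\1_(A i `&` A j) : T -> R).
    by apply/bA/measurableI.
  have int g : bounded_measurable g -> P.-integrable setT (EFin \o g).
    exact: bounded_measurable_integrable.
  rewrite RintegralB//; last 2 first.
  - by apply: int; exact: bounded_measurableB.
  - by apply: int; exact: bounded_measurableB.
  rewrite !RintegralB//; try exact: int.
  rewrite Rintegral_cst// !RintegralZl//; try exact/int/bA.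
  have EA k : \int[P]_w (\1_(A k) w : R) = p.
    by rewrite Rintegral_indic//; exact: (congr1 fine (PA k)).
  have EAA : \int[P]_w (\1_(A i `&` A j) w : R) = p * p.
    rewrite Rintegral_indic; first exact: (congr1 fine (PAA _ _ ij)).
    exact: measurableI.
  by rewrite !EA EAA P1; ring.
have := orthogonal_strong_law mxi xi1 xi0; apply: filterS => w xi_cvg.
have : (fun n => p + n%:R^-1 * \sum_(i < n) xi i w) @ \oo --> p + 0.
  by apply: cvgD => //; exact: cvg_cst.
rewrite addr0; apply: cvg_trans; apply: near_eq_cvg.
(* At [n = 0] the empirical mean is 0, so adding [p] back to the centred mean recovers it only from
   [n = 1] on. *)
exists 1%N => // n /= n1.
rewrite /xi sumrB sumr_const card_ord mulrBr -[p *+ n]mulr_natl mulrA.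
rewrite mulVf ?mul1r; first by ring.
by rewrite pnatr_eq0 -lt0n.
Qed.

(** * Frobenius norm estimates and the Lipschitz bound for radial quadratic functions *)

Lemma frobenius_ge0 (R : realType) (m n : nat) (A : 'M[R]_(m, n)) :
  0 <= frobenius A.
Proof. exact: sqrtr_ge0. Qed.

Lemma frobenius_cV_sqr (R : realType) (d : nat) (z : 'cV[R]_d) :
  frobenius z ^+ 2 = \sum_i z i 0 ^+ 2.
Proof.
rewrite sqr_sqrtr; first by apply: eq_bigr => i _; rewrite big_ord1.
by apply: sumr_ge0 => i _; apply: sumr_ge0 => j _; rewrite sqr_ge0.
Qed.

Lemma norm_coord_le_frobenius (R : realType) (d : nat) (z : 'cV[R]_d) i :
  `|z i 0| <= frobenius z.
Proof.
rewrite -(@ler_pXn2r _ 2)// ?nnegrE ?frobenius_ge0// frobenius_cV_sqr.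
rewrite (bigD1 i)//= real_normK ?num_real// lerDl.
by apply: sumr_ge0 => j _; rewrite sqr_ge0.
Qed.

(** A sum of squares of nonnegative numbers is at most the square of their sum; this is used once
    over rows and once over columns. *)
Lemma frobenius_le_sum (R : realType) (m n : nat) (A : 'M[R]_(m, n)) :
  frobenius A <= \sum_i \sum_j `|A i j|.
Proof.
have sqr_sum (I : finType) (a b : I -> R) :
    (forall i, 0 <= b i) -> (forall i, a i <= b i ^+ 2) ->
    \sum_i a i <= (\sum_i b i) ^+ 2.
  move=> b0 ab; rewrite expr2 mulr_suml; apply: ler_sum => i _.
  rewrite (le_trans (ab i))// expr2 ler_wpM2l// (bigD1 i)//= lerDl.
  exact: sumr_ge0.
have b0 i : 0 <= \sum_j `|A i j| by exact: sumr_ge0.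
rewrite -(@ler_pXn2r _ 2)// ?nnegrE ?frobenius_ge0 ?sumr_ge0//.
rewrite sqr_sqrtr; last first.
  by apply: sumr_ge0 => i _; apply: sumr_ge0 => j _; rewrite sqr_ge0.
by do 2!apply: (sqr_sum) => // ?; rewrite real_normK ?num_real.
Qed.

(** Multiply by [t + s]: both the difference of squared norms and each coordinate difference of
    squares factor, and the sum of two coordinates is at most [t + s] in absolute value. *)
Lemma frobenius_cV_dist (R : realType) (d : nat) (z w : 'cV[R]_d) :
  frobenius w - frobenius z <= \sum_i `|z i 0 - w i 0|.
Proof.
set s := frobenius z; set t := frobenius w.
have s0 : 0 <= s by exact: frobenius_ge0.
have t0 : 0 <= t by exact: frobenius_ge0.
have [ts0|] := leP (t + s) 0.
  by rewrite (@le_trans _ _ 0) ?sumr_ge0//; lra.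
move=> ts; rewrite -(ler_pM2r ts) -subr_sqr !frobenius_cV_sqr -sumrB mulr_suml.
apply: ler_sum => i _; rewrite subr_sqr (le_trans (ler_norm _))// normrM.
rewrite distrC ler_wpM2l// (le_trans (ler_normD _ _))// lerD//.
- exact: norm_coord_le_frobenius.
- exact: norm_coord_le_frobenius.
Qed.

Lemma radial_quadratic_lipschitz (R : realType) (d : nat) (g : R -> R) (B L : R)
    (i j : 'I_d) (z w : 'cV[R]_d) :
  (forall s, 0 <= s -> s * `|g s| <= B) ->
  (forall s t, 0 <= s -> s <= t -> s ^+ 2 * `|g t - g s| <= L * (t - s)) ->
  `|z i 0 * z j 0 * g (frobenius z) - w i 0 * w j 0 * g (frobenius w)| <=
    (2 * B + L) * \sum_k `|z k 0 - w k 0|.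
Proof.
(* The increment of g is only weighted by the smaller of the two radii. *)
move=> gB gL.
wlog zw : z w / frobenius z <= frobenius w.
  move=> H; have [/H//|/ltW/H] := leP (frobenius z) (frobenius w).
  by rewrite distrC; under eq_bigr do rewrite distrC.
set D := \sum_k _; set s := frobenius z; set t := frobenius w.
have s0 : 0 <= s by exact: frobenius_ge0.
have t0 : 0 <= t by exact: frobenius_ge0.
have D0 : 0 <= D by exact: sumr_ge0.
have zs k : `|z k 0| <= s by exact: norm_coord_le_frobenius.
have wt k : `|w k 0| <= t by exact: norm_coord_le_frobenius.
have zwD k : `|z k 0 - w k 0| <= D.
  by rewrite /D (bigD1 k)//= lerDl sumr_ge0.
have tsD : t - s <= D by exact: frobenius_cV_dist.
(* Taking radii 0 and 1 in the increment hypothesis kills its left side and leaves [L] on the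
   right. *)
have L0 : 0 <= L.
  have := gL 0 1 (lexx _) ler01.
  by rewrite expr0n/= mul0r subr0 mulr1.
(* Differences of coordinates are paired with [g] at the larger radius [t], where the remaining
   coordinate is at most [t] and [t * |g t| <= B]; this costs [2 * B * D]. The increment of [g] is
   paired with coordinates of size at most [s], which costs [L * D]. *)
have -> : z i 0 * z j 0 * g s - w i 0 * w j 0 * g t =
    ((z i 0 - w i 0) * z j 0 + w i 0 * (z j 0 - w j 0)) * g t
    - z i 0 * z j 0 * (g t - g s) by ring.
rewrite (le_trans (ler_normB _ _))// [leRHS]mulrDl lerD//.
  rewrite normrM (@le_trans _ _ (2 * (D * (t * `|g t|))))//; last first.
    by rewrite -mulrA ler_wpM2l// mulrC ler_wpM2r// gB.
  rewrite [leRHS](_ : _ = (D * t + t * D) * `|g t|); last by ring.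
  rewrite ler_wpM2r// (le_trans (ler_normD _ _))// !normrM lerD//.
    by rewrite ler_pM// (le_trans (zs j)).
  by rewrite ler_pM.
rewrite !normrM (le_trans (ler_wpM2r (normr_ge0 _) (ler_pM _ _ (zs i) (zs j))))//.
by rewrite -expr2 (le_trans (gL _ _ s0 zw))// ler_wpM2l.
Qed.

(** Mean value theorem for [h u = f (u ^ 2 / sigma ^ 2)]: at the intermediate point [c], the
    hypothesis on [f'] reads [c ^ 3 * |f'| <= sigma ^ 3 * A1], and the weight satisfies
    [s ^ 2 <= c ^ 2], matching the factor [2 * c / sigma ^ 2] of the chain rule. *)
Lemma profile_increment (R : realType) (f : R -> R) (A1 sigma s t : R) :
  (forall r : R, 0 < r -> derivable f r 1) ->
  (forall r : R, 0 <= r -> r `^ (3 / 2) * `|derive1 f r| <= A1) ->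
  0 < sigma -> 0 <= s -> s <= t ->
  s ^+ 2 * `|f (t ^+ 2 / sigma ^+ 2) - f (s ^+ 2 / sigma ^+ 2)| <=
    2 * sigma * A1 * (t - s).
Proof.
move=> df fA sg0; have A10 : 0 <= A1.
  by rewrite (le_trans _ (fA 0 _))// mulr_ge0// powR_ge0.
(* For [s = 0] the weight vanishes. Otherwise [[s, t]] stays away from 0, where two-sided
   differentiability of [f] is not assumed. *)
have sg0' := ltW sg0; rewrite le_eqVlt => /predU1P[<- t0|s0].
  by rewrite expr0n/= mul0r subr0 !mulr_ge0.
rewrite le_eqVlt => /predU1P[->|st]; first by rewrite !subrr normr0 !mulr0.
pose h u := f (u ^+ 2 / sigma ^+ 2).
have hd (u : R) : 0 < u ->
    is_derive u 1 h (2 * u / sigma ^+ 2 * derive1 f (u ^+ 2 / sigma ^+ 2)).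
  move=> u0; have r0 : 0 < u ^+ 2 / sigma ^+ 2 by rewrite divr_gt0 ?exprn_gt0.
  have fd : is_derive (u ^+ 2 / sigma ^+ 2) 1 f (derive1 f (u ^+ 2 / sigma ^+ 2)).
    by apply: DeriveDef; [exact: df|rewrite derive1E].
  have qd : is_derive u 1 (fun v : R => v ^+ 2 / sigma ^+ 2) (2 * u / sigma ^+ 2).
    apply: is_derive_eq; rewrite /GRing.scale/=; ring.
  rewrite mulrC; exact: (@is_derive1_comp _ f (fun v : R => v ^+ 2 / sigma ^+ 2)).
have hst u : u \in `]s, t[ ->
    is_derive u 1 h (2 * u / sigma ^+ 2 * derive1 f (u ^+ 2 / sigma ^+ 2)).
  by rewrite in_itv/= => /andP[su _]; exact/hd/(lt_trans s0).
have hcont : {within `[s, t], continuous h}.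
  apply: derivable_within_continuous => u; rewrite in_itv/= => /andP[su _].
  exact: (@ex_derive _ _ _ _ _ _ _ (hd u (lt_le_trans s0 su))).
have [c + hE] := MVT st hst hcont; rewrite in_itv/= => /andP[sc ct].
have c_gt0 : 0 < c by exact: lt_trans sc.
have c0 : 0 < c by exact: lt_trans sc.
have csg0 : 0 <= c / sigma by rewrite divr_ge0// ltW.
have powE : (c ^+ 2 / sigma ^+ 2) `^ (3 / 2) = (c / sigma) ^+ 3.
  rewrite -expr_div_n -powR_mulrn// -powRrM (_ : 2%:R * (3 / 2) = 3%:R).
    by rewrite powR_mulrn.
  by field.
have fAc : c ^+ 3 * `|derive1 f (c ^+ 2 / sigma ^+ 2)| <= sigma ^+ 3 * A1.
  rewrite [leRHS]mulrC -ler_pdivrMr ?exprn_gt0// mulrAC -expr_div_n -powE.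
  by rewrite fA// divr_ge0// sqr_ge0.
have ts0 : 0 <= t - s by rewrite subr_ge0 ltW.
rewrite -/(h t) -/(h s) hE !normrM (ger0_norm ts0) mulrA ler_wpM2r//.
rewrite (@ger0_norm _ (sigma ^+ 2)^-1) ?invr_ge0 ?exprn_ge0//.
rewrite (ger0_norm (ltW c_gt0)) ger0_norm//.
move: fAc; set D := `|_| => fAc.
have D0 : 0 <= D by exact: normr_ge0.
rewrite (@le_trans _ _ (2 / sigma ^+ 2 * (c ^+ 3 * D)))//.
  rewrite [leRHS](_ : _ = c ^+ 2 * (2 * c / sigma ^+ 2 * D)); last by ring.
  rewrite ler_wpM2r ?mulr_ge0 ?invr_ge0 ?sqr_ge0 ?(ltW c_gt0)//.
  by rewrite ler_pXn2r ?nnegrE ?(ltW c_gt0) ?ltW.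
rewrite (le_trans (ler_wpM2l _ fAc))// ?divr_ge0 ?sqr_ge0//.
rewrite le_eqVlt; apply/orP; left; apply/eqP; field.
by rewrite gt_eqF.
Qed.

(** * Measurability, boundedness and Lipschitz continuity of the covariance integrands *)

Lemma measurable_coord (R : realType) (d : nat) (i : 'I_d) :
  measurable_fun setT (fun y : 'cV[R]_d => y i 0).
Proof.
apply: (measurability _ (RGenOpens.measurableE R)).
move=> /= _ [_ [a [b ->]] <-]; rewrite setTI; apply: sub_sigma_algebra.
apply: (@open_comp _ _ (fun y : 'cV[R]_d => y i 0)); last exact: interval_open.
by move=> y _; exact: coord_continuous.
Qed.

Definition covariance_integrand (R : realType) (d : nat) (f : R -> R)
    (sigma : R) (x : 'cV[R]_d) (i j : 'I_d) (y : 'cV[R]_d) : R :=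
  ((y - x) *m (y - x)^T) i j * multiscale_kernel f x y sigma.

Lemma covariance_integrandE (R : realType) (d : nat) (f : R -> R)
    (sigma : R) (x : 'cV[R]_d) (i j : 'I_d) (y : 'cV[R]_d) :
  covariance_integrand f sigma x i j y =
    (y - x) i 0 * (y - x) j 0 *
    ((kernel_normalization d f sigma)^-1 *
     f (frobenius (y - x) ^+ 2 / sigma ^+ 2)).
Proof. by rewrite /covariance_integrand !mxE big_ord1 !mxE. Qed.

Lemma measurable_covariance_integrand (R : realType) (d : nat) (f : R -> R)
    (sigma : R) (x : 'cV[R]_d) (i j : 'I_d) :
  measurable_fun (`[0, +oo[ : set R) f ->
  measurable_fun setT (covariance_integrand f sigma x i j).
Proof.
move=> mf; rewrite (funext (covariance_integrandE f sigma x i j)).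
have mc k : measurable_fun setT (fun y : 'cV[R]_d => (y - x) k 0).
  under eq_fun do rewrite !mxE.
  by apply: measurable_funB => //; exact: measurable_coord.
apply: measurable_funM; first exact: measurable_funM.
apply: measurable_funM => //.
have mg : measurable_fun setT
    (fun y : 'cV[R]_d => frobenius (y - x) ^+ 2 / sigma ^+ 2).
  apply: measurable_funM => //; under eq_fun do rewrite frobenius_cV_sqr.
  by apply: measurable_sum => k; exact: measurable_funX.
apply: (measurable_comp _ _ mf mg) => // _ [y _ <-].
by rewrite /= in_itv/= andbT divr_ge0 ?sqr_ge0.
Qed.

(** With [r = t ^ 2 / sigma ^ 2], the two coordinates contribute at most [t ^ 2 = sigma ^ 2 * r], so
    the decay [r * f r <= C] applies. The bound is free of [x]. *)
Lemma covariance_integrand_bound (R : realType) (d : nat) (f : R -> R)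
    (sigma C : R) (x : 'cV[R]_d) (i j : 'I_d) (y : 'cV[R]_d) :
  0 < sigma ->
  (forall r, 0 <= r -> 0 <= f r) -> (forall r, 0 <= r -> r * f r <= C) ->
  `|covariance_integrand f sigma x i j y| <=
    sigma ^+ 2 * (`|(kernel_normalization d f sigma)^-1| * C).
Proof.
move=> s0 f0 fC; rewrite covariance_integrandE.
move: (y - x) => z {x y}; set c := _^-1; set t := frobenius z.
have t0 : 0 <= t by exact: frobenius_ge0.
have r0 : 0 <= t ^+ 2 / sigma ^+ 2 by rewrite divr_ge0 ?sqr_ge0.
rewrite !normrM (ger0_norm (f0 _ r0)).
rewrite (@le_trans _ _ (t * t * (`|c| * f (t ^+ 2 / sigma ^+ 2))))//.
  rewrite ler_wpM2r ?mulr_ge0 ?f0// ler_pM//.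
  - exact: norm_coord_le_frobenius.
  - exact: norm_coord_le_frobenius.
have -> : t * t * (`|c| * f (t ^+ 2 / sigma ^+ 2)) =
    sigma ^+ 2 * (`|c| * (t ^+ 2 / sigma ^+ 2 * f (t ^+ 2 / sigma ^+ 2))).
  by field; rewrite gt_eqF.
by rewrite ler_wpM2l ?sqr_ge0// ler_wpM2l// fC.
Qed.

Lemma covariance_integrand_lipschitz (R : realType) (d : nat) (f : R -> R)
    (sigma A1 : R) :
  admissible_profile d f -> (forall r : R, 0 < r -> derivable f r 1) ->
  (forall r : R, 0 <= r -> r `^ (3 / 2) * `|derive1 f r| <= A1) ->
  0 < sigma ->
  exists2 L : R, 0 <= L & forall (x : 'cV[R]_d) i j y y',
    `|covariance_integrand f sigma x i j y
      - covariance_integrand f sigma x i j y'| <=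
    L * \sum_k `|y k 0 - y' k 0|.
Proof.
move=> [_ [M fM] f0 _ [C C0 fC] _] df fA s0.
pose c := (kernel_normalization d f sigma)^-1.
pose g s := c * f (s ^+ 2 / sigma ^+ 2).
have s0' := ltW s0.
have M0 : 0 <= M by rewrite (le_trans _ (fM 0 _)).
have A10 : 0 <= A1 by rewrite (le_trans _ (fA 0 _))// mulr_ge0// powR_ge0.
have gB s : 0 <= s -> s * `|g s| <= `|c| * (sigma * (M + C)).
  move=> s_ge0; pose u := s / sigma.
  have u0 : 0 <= u by rewrite divr_ge0.
  have -> : s * `|g s| = `|c| * (sigma * (u * `|f (u ^+ 2)|)).
    by rewrite /g /u normrM expr_div_n; field; rewrite gt_eqF.
  rewrite ler_wpM2l// ler_wpM2l//.
  (* For [u <= 1] the bound [M] on [f] suffices; for [u >= 1], [u <= u ^ 2] brings in the decay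
     constant [C]. *)
  have [u1|/ltW u1] := leP u 1.
    by rewrite (le_trans (ler_pM _ _ u1 (fM _ (sqr_ge0 _))))// mul1r lerDl ltW.
  rewrite (@le_trans _ _ (u ^+ 2 * f (u ^+ 2)))//.
    by rewrite ger0_norm ?f0 ?sqr_ge0// ler_wpM2r ?f0 ?sqr_ge0// expr2 ler_peMl.
  by rewrite (le_trans (fC _ (sqr_ge0 _)))// lerDr.
have gL s t : 0 <= s -> s <= t ->
    s ^+ 2 * `|g t - g s| <= `|c| * (2 * sigma * A1) * (t - s).
  move=> s_ge0 st; rewrite /g -mulrBr normrM mulrCA -[leRHS]mulrA ler_wpM2l//.
  exact: profile_increment.
exists (2 * (`|c| * (sigma * (M + C))) + `|c| * (2 * sigma * A1)).
  by rewrite addr_ge0// !mulr_ge0// ?mulr_ge0// addr_ge0// ltW.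
move=> x i j y y'; rewrite !covariance_integrandE.
rewrite (le_trans (radial_quadratic_lipschitz i j (y - x) (y' - x) gB gL))//.
under eq_bigr do rewrite !mxE opprB addrA subrK.
by [].
Qed.

(** * Grid cells, step approximation and uniform convergence of integrals *)

Definition grid_index (R : realType) (d m : nat) (y : 'cV[R]_d) : nat :=
  choice.pickle [ffun i : 'I_d => Num.floor (y i 0 * m.+1%:R)].

(** [choice.pickle] is injective, so equal indices mean equal floors of all scaled coordinates; each
    coordinate then varies by at most [1 / m.+1]. *)
Lemma grid_index_dist (R : realType) (d m : nat) (y y' : 'cV[R]_d) :
  grid_index m y = grid_index m y' ->
  \sum_k `|y k 0 - y' k 0| <= d%:R / m.+1%:R.
Proof.
move=> /(pcan_inj (@choice.pickleK _))/ffunP yy'.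
rewrite -[d in d%:R]card_ord mulr_natl -sumr_const; apply: ler_sum => k _.
have := yy' k; rewrite !ffunE => flE.
have m0 : 0 < m.+1%:R :> R by [].
rewrite -[leRHS]mul1r ler_pdivlMr// -[X in _ * X](ger0_norm (ltW m0)) -normrM.
have /andP[] := floor_itv (y k 0 * m.+1%:R).
have /andP[] := floor_itv (y' k 0 * m.+1%:R).
rewrite flE intrD mulrBl ler_norml; lra.
Qed.

(** A single index gives either a box, which is a finite intersection of coordinate slabs, or the
    empty set when it encodes no vector of integers. A countable union then reaches any set of
    indices, in particular the tails. *)
Lemma measurable_grid_index (R : realType) (d m : nat) (S : set nat) :
  measurable (@grid_index R d m @^-1` S).
Proof.
have mcell (a : {ffun 'I_d -> int}) :
    measurable [set y : 'cV[R]_d | grid_index m y = choice.pickle a].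
  rewrite (_ : mkset _ = \bigcap_(i in [set: 'I_d])
      (fun y : 'cV[R]_d => y i 0 * m.+1%:R) @^-1`
        `[(a i)%:~R, (a i + 1)%:~R[%classic).
    apply: fin_bigcap_measurable => // i _; rewrite -[X in measurable X]setTI.
    have mi : measurable_fun setT (fun y : 'cV[R]_d => y i 0 * m.+1%:R).
      by apply: measurable_funM => //; exact: measurable_coord.
    exact: mi.
  apply/seteqP; split => y /=.
    move=> /(pcan_inj (@choice.pickleK _)) <- i _; rewrite ffunE/= in_itv/=.
    exact: floor_itv.
  move=> ya; congr choice.pickle; apply/ffunP => i; rewrite ffunE.
  by apply: floor_def; have := ya i I; rewrite /= in_itv.
rewrite (_ : _ @^-1` S = \bigcup_n (if `[< S n >] then
    grid_index m @^-1` [set n] else set0 : set 'cV[R]_d)).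
  apply: bigcup_measurable => n _; case: ifP => // _.
  have [[a an]|] := pselect (exists a : {ffun 'I_d -> int}, choice.pickle a = n).
    by have := mcell a; rewrite an.
  move=> nex; rewrite (_ : _ @^-1` _ = set0)//.
  by apply/seteqP; split => // y /= yn; apply: nex; eexists; exact: yn.
apply/seteqP; split => [y /= Sy|y [n _]].
  by exists (grid_index m y) => //; case: asboolP.
by case: asboolP => // Sn /= ->.
Qed.

(** The finite sum is the integral of the step function equal to [q n] on cell [n < N] and to 0
    elsewhere. Its pointwise distance to [g] is at most [e] on the first [N] cells and [B] on the
    tail. *)
Lemma step_approximation (R : realType) (disp : measure_display)
    (T : measurableType disp) (nu : {measure set T -> \bar R}) (p : T -> nat)
    (q : nat -> R) (g : T -> R) (B e : R) (N : nat) :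
  nu setT = 1%E -> (forall S, measurable (p @^-1` S)) ->
  measurable_fun setT g -> (forall y, `|g y| <= B) ->
  0 <= e -> (forall y, `|g y - q (p y)| <= e) ->
  `|\int[nu]_y g y - \sum_(n < N) q n * fine (nu (p @^-1` [set (n : nat)]))| <=
    e + B * fine (nu (p @^-1` [set n | (N <= n)%N])).
Proof.
move=> nu1 mp mg gB e0 gq.
have nufin : (nu setT < +oo)%E by rewrite nu1 ltry.
have int h : bounded_measurable h -> nu.-integrable setT (EFin \o h).
  exact: bounded_measurable_integrable.
have b1 S : bounded_measurable (\1_(p @^-1` S) : T -> R).
  exact: bounded_measurable_indic.
have bc (c : R) : bounded_measurable (fun=> c : R).
  exact: bounded_measurable_cst.
have bg : bounded_measurable g by split; last by exists B.
have bq n : bounded_measurable (fun y => q n * \1_(p @^-1` [set n]) y).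
  by apply: bounded_measurableM; [exact: bc|exact: b1].
set tail := p @^-1` _.
pose h y := \sum_(n < N) q n * \1_(p @^-1` [set (n : nat)]) y.
have bh : bounded_measurable h.
  exact: (@bounded_measurable_sum _ _ _
    (fun n y => q n * \1_(p @^-1` [set (n : nat)]) y)).
have -> : \sum_(n < N) q n * fine (nu (p @^-1` [set (n : nat)])) =
    \int[nu]_y h y.
  rewrite (@Rintegral_sum _ _ _ _
    (fun n y => q n * \1_(p @^-1` [set (n : nat)]) y))//.
  apply: eq_bigr => n _; rewrite RintegralZl//; last exact/int/b1.
  by rewrite Rintegral_indic.
rewrite -RintegralB//; [|exact: int..].
have bgh : bounded_measurable (fun y => g y - h y).
  exact: bounded_measurableB.
rewrite (le_trans (le_normr_Rintegral _ _))//; first exact: int.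
have btail : bounded_measurable (fun y => B * \1_tail y).
  by apply: bounded_measurableM; [exact: bc|exact: b1].
have -> : e + B * fine (nu tail) = \int[nu]_y (e + B * \1_tail y).
  rewrite RintegralD//; [|exact: int..].
  rewrite RintegralZl//; last exact/int/b1.
  by rewrite Rintegral_indic//; [rewrite Rintegral_cst// nu1 mulr1|exact: mp].
apply: le_Rintegral => //.
- exact/int/bounded_measurable_norm.
- exact/int/bounded_measurableD.
move=> y _; rewrite /h /tail indicE.
have [yN|Ny] := ltnP (p y) N.
  rewrite (bigD1 (Ordinal yN))//= big1 ?addr0 => [|n nE].
    rewrite indicE mem_set//= mulr1 memNset ?mulr0 ?addr0//=.
    by rewrite leqNgt yN.
  rewrite indicE memNset ?mulr0//= => pyn.
  by move/eqP : nE; apply; apply: val_inj.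
rewrite big1 ?subr0 => [|n _].
  by rewrite mem_set//= mulr1 (le_trans (gB y))// lerDr.
rewrite indicE memNset ?mulr0//= => pyn.
by have := ltn_ord n; rewrite -pyn ltnNge Ny.
Qed.

(** Step approximation under both measures reduces the difference to masses of finitely many cells
    and of one tail. A function of [G] enters only through [B] and [L], so the threshold on [k] is
    chosen before the function. *)
Lemma uniform_convergence_integrals (R : realType) (disp : measure_display)
    (T : measurableType disp) (mu : {measure set T -> \bar R})
    (nu : nat -> {measure set T -> \bar R}) (p : nat -> T -> nat)
    (G : set (T -> R)) (B L : R) :
  mu setT = 1%E -> (\forall k \near \oo, nu k setT = 1%E) ->
  (forall m S, measurable (p m @^-1` S)) ->
  (forall m n, (fun k => fine (nu k (p m @^-1` [set n]))) @ \oo -->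
               fine (mu (p m @^-1` [set n]))) ->
  (forall m N, (fun k => fine (nu k (p m @^-1` [set n | (N <= n)%N]))) @ \oo -->
               fine (mu (p m @^-1` [set n | (N <= n)%N]))) ->
  0 <= B -> 0 <= L ->
  (forall g, G g -> measurable_fun setT g) ->
  (forall g, G g -> forall y, `|g y| <= B) ->
  (forall g, G g -> forall m y y', p m y = p m y' ->
    `|g y - g y'| <= L / m.+1%:R) ->
  forall e, 0 < e -> \forall k \near \oo,
    forall g, G g -> `|\int[nu k]_y g y - \int[mu]_y g y| <= e.
Proof.
move=> mu1 nu1 mp cell tail B0 L0 mG GB GL e e0.
(* The final budget counts six errors of at most [e / 8]: one mesh error per measure, one tail term
   for [mu], two for [nu k], and one for the cell masses. Using [B + 1] avoids dividing by 0 when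
   [B = 0]. *)
pose eta := e / (8 * (B + 1)).
have B1 : 0 < B + 1 by rewrite ltr_wpDl.
have eta0 : 0 < eta by rewrite divr_gt0// mulr_gt0.
have Beta : B * eta <= e / 8.
  rewrite /eta mulrA ler_pdivrMr ?mulr_gt0//.
  rewrite (_ : e / 8 * (8 * (B + 1)) = e * B + e); first by lra.
  by field.
pose m := Num.bound (L * 8 / e).
have Lm : L / m.+1%:R <= e / 8.
  rewrite ler_pdivrMr// -ler_pdivrMl ?divr_gt0// invf_div mulrC mulrA.
  apply: (@le_trans _ _ m%:R); last by rewrite ler_nat.
  by rewrite ltW// archi_boundP// !mulr_ge0// invr_ge0 ltW.
have mufin S : mu (p m @^-1` S) \is a fin_num.
  rewrite ge0_fin_numE// (@le_lt_trans _ _ (mu setT))//; last by rewrite mu1 ltry.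
  by apply: le_measure => //; rewrite inE; [exact: mp|exact: measurableT].
(* The tails decrease to the empty set, so continuity from above of the finite measure [mu] makes
   one of them small. *)
have [N muN] : exists N, fine (mu (p m @^-1` [set n | (N <= n)%N])) <= eta.
  have : (mu \o (fun N => p m @^-1` [set n | (N <= n)%N])) @ \oo -->
      mu (\bigcap_N p m @^-1` [set n | (N <= n)%N]).
    apply: nonincreasing_cvg_mu => //.
    - by rewrite ltey_eq mufin.
    - by apply: bigcapT_measurable => N; exact: mp.
    - move=> N N' NN'; apply/subsetPset => y /=; exact: leq_trans.
  rewrite (_ : \bigcap_N _ = set0) ?measure0; last first.
    apply/seteqP; split => // y /(_ (p m y).+1 I) /=.
    by rewrite ltnn.
  move=> /fine_cvgP[_] /cvgr0Pnorm_le/(_ _ eta0) [N _ /(_ N (leqnn N))] /=.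
  by move=> /(le_trans (ler_norm _)); exists N.
have sumcvg : (fun k => \sum_(n < N) `|fine (nu k (p m @^-1` [set (n : nat)]))
    - fine (mu (p m @^-1` [set (n : nat)]))|) @ \oo --> (0 : R).
  elim: N {muN} => [|n IHn].
    by under eq_fun do rewrite big_ord0; exact: cvg_cst.
  under eq_fun do rewrite big_ord_recr /=.
  have H : (fun k => fine (nu k (p m @^-1` [set n]))
      - fine (mu (p m @^-1` [set n]))) @ \oo --> (0 : R).
    by apply/subr_cvg0; exact: cell.
  by have := cvgD IHn (cvg_norm H); rewrite normr0 addr0; apply.
have := tail m N => /cvgrPdist_le/(_ _ eta0) tailN.
have /cvgr0Pnorm_le/(_ _ eta0) sumN := sumcvg.
near=> k => g Gg.
have nu1k : nu k setT = 1%E by near: k.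
have tailk : `|fine (mu (p m @^-1` [set n | (N <= n)%N]))
    - fine (nu k (p m @^-1` [set n | (N <= n)%N]))| <= eta by near: k.
have sumk : `|\sum_(n < N) `|fine (nu k (p m @^-1` [set (n : nat)]))
    - fine (mu (p m @^-1` [set (n : nat)]))| | <= eta by near: k.
(* [q n] samples [g] in cell [n]. On an empty cell it is the value at the default [point], which no
   [y] of that cell ever tests and which is still bounded by [B]. *)
pose q n := g (xget point (p m @^-1` [set n])).
have gq y : `|g y - q (p m y)| <= L / m.+1%:R.
  apply: GL => //; apply/esym.
  exact: (@xgetI _ point (p m @^-1` [set p m y]) y erefl).
have Lm0 : 0 <= L / m.+1%:R by rewrite divr_ge0.
have := step_approximation N nu1k (mp m) (mG _ Gg) (GB _ Gg) Lm0 gq.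
have := step_approximation N mu1 (mp m) (mG _ Gg) (GB _ Gg) Lm0 gq.
set Imu := \int[mu]_y g y; set Ink := \int[nu k]_y g y.
set tmu := fine (mu _) in muN tailk *; set tnu := fine (nu k _) in tailk *.
set Smu := \sum_(n < N) _ => Amu; set Snu := \sum_(n < N) _ => Anu.
have SS : `|Snu - Smu| <= B * eta.
  rewrite -sumrB (le_trans (ler_norm_sum _ _ _))//.
  rewrite (@le_trans _ _ (B * `|\sum_(n < N) `|fine (nu k (p m @^-1` [set (n : nat)]))
    - fine (mu (p m @^-1` [set (n : nat)]))| |))//; last by rewrite ler_wpM2l.
  rewrite ger0_norm ?sumr_ge0// mulr_sumr; apply: ler_sum => n _.
  by rewrite -mulrBr normrM ler_wpM2r// GB.
have Btmu : B * tmu <= B * eta by rewrite ler_wpM2l.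
have Btnu : B * tnu <= B * (2 * eta).
  by rewrite ler_wpM2l//; move: tailk; rewrite ler_norml; lra.
have -> : Ink - Imu = (Ink - Snu) + (Snu - Smu) - (Imu - Smu) by ring.
rewrite (le_trans (ler_normB _ _))// (le_trans (lerD (ler_normD _ _) (lexx _)))//.
move: Lm Beta Amu Anu SS Btmu Btnu; rewrite [B * (2 * _)]mulrCA.
move: (L / _) (B * eta) (B * tmu) (B * tnu) `|Ink - Snu| `|Snu - Smu| `|Imu - Smu|.
by move=> *; lra.
Unshelve. all: by end_near.
Qed.

(** * Empirical measures and the conclusion *)

Lemma empirical_measureE (R : realType) (disp : measure_display)
    (T : measurableType disp) (y : nat -> T) (n : nat) (A : set T) :
  empirical_measure R y n A = (n%:R^-1 * \sum_(i < n) \1_A (y i))%:E.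
Proof.
by rewrite /empirical_measure /mscale/= /msum EFinM -sumEFin.
Qed.

Lemma empirical_measure_cvg (R : realType) (disp disp' : measure_display)
    (Omega : measurableType disp) (T : measurableType disp')
    (P : probability Omega R) (y : nat -> {RV P >-> T})
    (alpha : probability T R) (A : set T) :
  iid_with_distribution y alpha -> measurable A ->
  {ae P, forall w, (fun n => fine (empirical_measure R (fun i => y i w) n A))
    @ \oo --> fine (alpha A)}.
Proof.
move=> [ind dist] mA.
have Palpha i : P (y i @^-1` A) = (fine (alpha A))%:E.
  by rewrite fineK ?fin_num_measure//; have := dist i A mA.
have := @strong_law_events R _ _ P (fun i => y i @^-1` A) (fine (alpha A)).
have my i : measurable (y i @^-1` A) by rewrite -[X in measurable X]setTI; exact: measurable_funPT.
move=> /(_ my Palpha) slln.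
have : {ae P, forall w,
    (fun n => n%:R^-1 * \sum_(i < n) \1_(y i @^-1` A) w) @ \oo --> fine (alpha A)}.
  apply: slln => i j ij.
  (* Pairwise independence is mutual independence on the two-element index set, with the same event
     [A] at both indices. *)
  have := ind [fset i; j]%fset (fun=> A) (fun=> mA).
  rewrite big_fsetU1 ?inE//= big_seq_fset1 !Palpha EFinM => <-.
  congr (P _); apply/seteqP; split => [w [wi wj] k /=|w H].
    by rewrite !inE => /orP[/eqP->|/eqP->].
  by split; apply: H; rewrite /= !inE eqxx ?orbT.
apply: filterS => w; under eq_fun do under eq_bigr do rewrite indicE.
move=> H; under eq_fun do rewrite empirical_measureE/=.
by under eq_fun do under eq_bigr do rewrite indicE.
Qed.

Theorem corollary1 (R : realType) (d : nat) (hd : (1 <= d)%N) (f : R -> R)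
    (hf : admissible_profile d f)
    (hdf : differentiable_profile f)
    (A1 : R) (hA1 : 0 < A1)
    (hf' : forall r : R, 0 <= r -> r `^ (3 / 2) * `|derive1 f r| <= A1)
    (sigma : R) (hsigma : 0 < sigma)
    (alpha : probability 'cV[R]_d R) (halpha : finite_first_moment alpha)
    (disp : measure_display) (Omega : measurableType disp)
    (P : probability Omega R) (y : nat -> {RV P >-> 'cV[R]_d})
    (hy : iid_with_distribution y alpha) :
  {ae P, forall w : Omega,
    (fun n : nat =>
       ereal_sup (range (fun x : 'cV[R]_d =>
         (frobenius
            (multiscale_covariance f
               (empirical_measure R (fun i => y i w) n) x sigma
             - multiscale_covariance f alpha x sigma))%:E)))
      @ \oo --> (0 : \bar R)%E}.
Proof.
have [mf _ f_ge0 _ [C C0 fC] _] := hf.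
have [L L0 hL] := covariance_integrand_lipschitz hf hdf.1 hf' hsigma.
pose B := sigma ^+ 2 * (`|(kernel_normalization d f sigma)^-1| * C).
have B0 : 0 <= B by rewrite mulr_ge0 ?sqr_ge0// mulr_ge0// ltW.
pose nu w k := empirical_measure R (fun i => y i w) k.
pose cell m n : set 'cV[R]_d := grid_index m @^-1` [set n].
pose tail m n : set 'cV[R]_d := grid_index m @^-1` [set k | (n <= k)%N].
(* The pairs [(m, n)] are countable, so one null set serves all cells, and likewise all tails. *)
have cvg_ae (S : nat -> nat -> set 'cV[R]_d) : (forall m n, measurable (S m n)) ->
    {ae P, forall w m n, (fun k => fine (nu w k (S m n))) @ \oo -->
                         fine (alpha (S m n))}.
  move=> mS; do 2 apply: ae_foralln => ?; exact: empirical_measure_cvg.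
have aecell := cvg_ae cell (fun m n => @measurable_grid_index R d m _).
have aetail := cvg_ae tail (fun m n => @measurable_grid_index R d m _).
(* From here on [w] is fixed and the argument is deterministic. *)
move: aecell aetail; apply: filterS2 => w cellw tailw.
pose G : set ('cV[R]_d -> R) :=
  [set g | exists x i j, g = covariance_integrand f sigma x i j].
(* At [k = 0] the empirical measure is zero, so its total mass is 1 only from [k = 1] on. *)
have nu1 : \forall k \near \oo, nu w k setT = 1%E.
  exists 1%N => // k /= k1; rewrite /nu empirical_measureE.
  under eq_bigr do rewrite indicT.
  by rewrite sumr_const card_ord mulVf// pnatr_eq0 -lt0n.
have Gm g : G g -> measurable_fun setT g.
  by move=> [x [i [j ->]]]; exact: measurable_covariance_integrand.
have Gb g : G g -> forall z, `|g z| <= B.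
  by move=> [x [i [j ->]]] z; exact: covariance_integrand_bound.
have Gl g : G g -> forall m z z', grid_index m z = grid_index m z' ->
    `|g z - g z'| <= L * d%:R / m.+1%:R.
  move=> [x [i [j ->]]] m z z' zz'.
  by rewrite (le_trans (hL _ _ _ _ _))// -mulrA ler_wpM2l// grid_index_dist.
have conv := @uniform_convergence_integrals _ _ _ alpha (nu w)
  (@grid_index R d) G B (L * d%:R) (probability_setT _) nu1
  (@measurable_grid_index R d) cellw tailw B0 (mulr_ge0 L0 (ler0n _ _)).
have {}conv e : 0 < e -> \forall k \near \oo, forall x i j,
    `|\int[nu w k]_y covariance_integrand f sigma x i j y
      - \int[alpha]_y covariance_integrand f sigma x i j y| <= e.
  move=> e0; apply: filterS (conv Gm Gb Gl e e0) => k Hk x i j.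
  by apply: Hk; exists x, i, j.
set err := (X in X @ _ --> _).
have err_bound e : 0 < e -> \forall k \near \oo, (0 <= err k <= e%:E)%E.
  (* The [d * d] entries share the error [e]; the successor keeps the denominator positive. For the
     lower bound, the supremum dominates the nonnegative value at [x = 0]. *)
  move=> e0; have e'0 : 0 < e / (d * d).+1%:R by rewrite divr_gt0.
  apply: filterS (conv _ e'0) => k Hk; apply/andP; split.
    apply: (@le_trans _ _ (frobenius (multiscale_covariance f (nu w k) 0 sigma
      - multiscale_covariance f alpha 0 sigma))%:E).
      by rewrite lee_fin frobenius_ge0.
    by apply: ereal_sup_ubound; exists 0.
  apply: ge_ereal_sup => _ [x _ <-]; rewrite lee_fin.
  rewrite (le_trans (frobenius_le_sum _))//.
  rewrite (@le_trans _ _ (\sum_(i < d) \sum_(j < d) e / (d * d).+1%:R))//.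
    by apply: ler_sum => i _; apply: ler_sum => j _; rewrite !mxE; exact: Hk.
  rewrite !sumr_const !card_ord -mulrnA -[leLHS]mulr_natr.
  by rewrite mulrAC ler_pdivrMr// ler_wpM2l ?(ltW e0)// ler_nat.
apply/fine_cvgP; split.
  apply: filterS (err_bound 1 ltr01) => k /andP[err0 err1].
  by rewrite ge0_fin_numE// (le_lt_trans err1)// ltry.
apply/cvgr0Pnorm_le => e e0; apply: filterS (err_bound e e0) => k /andP[err0 erre].
rewrite /= ger0_norm ?fine_ge0// -lee_fin fineK//.
by rewrite ge0_fin_numE// (le_lt_trans erre)// ltry.
Qed.
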